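(* Let $v\in\{a,b\}^*$ be non-constant (i.e. containing both letters) and $w=a\psi(v)b$. Then $\partial w=a\psi({}_+v)b$.
   Context: Alphabet $\mathcal A=\{a,b\}$. The right palindromic closure $u^{(+)}$ of $u$ is the shortest palindrome having prefix $u$. The palindromization map $\psi$: $\psi(\varepsilon)=\varepsilon$, $\psi(ux)=(\psi(u)x)^{(+)}$ ($u\in\mathcal A^*,x\in\mathcal A$). Proper Christoffel words are the words $a\psi(v)b$, $v\in\mathcal A^*$. Write a nonempty $v$ uniquely as $x_0^{\alpha_0}\cdots x_n^{\alpha_n}$ with $\alpha_i\ge1$, $x_{i+1}\ne x_i$; the index of $a\psi(v)b$ is $0$ if $v=\varepsilon$ and $\alpha_0$ otherwise. For $k\ge0$, $\varphi_k:a\mapsto a^{k+1}b,\ b\mapsto a^kb$ and $\hat\varphi_k:a\mapsto ab^k,\ b\mapsto ab^{k+1}$. The derivative of a proper Christoffel word $w=a\psi(v)b$ of index $k$ is: $\partial ab=a$ if $k=0$; $\partial w=\varphi_k^{-1}(w)$ if $k>0$ and $v$ begins with $a$; $\partial w=\hat\varphi_k^{-1}(w)$ if $k>0$ and $v$ begins with $b$ (in these cases $w$ lies in $\varphi_k(\mathcal A^* )$, resp. $\hat\varphi_k(\mathcal A^* )$, and the morphisms are injective). For a non-constant word $v$, ${}_+v$ denotes the longest suffix of $v$ which is immediately preceded by the letter different from the first letter of $v$. *)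

(* Defs.v *)
From HB Require Import structures.
From mathcomp Require Import all_boot.
From mathcomp Require Import boolp classical_sets.

Set Implicit Arguments.
Unset Strict Implicit.
Unset Printing Implicit Defensive.

Local Open Scope classical_set_scope.

Inductive letter : Type := La | Lb.

Definition bool_of_letter (x : letter) : bool := if x is La then false else true.
Definition letter_of_bool (x : bool) : letter := if x then Lb else La.

Lemma bool_of_letterK : cancel bool_of_letter letter_of_bool.
Proof. by case. Qed.

HB.instance Definition _ := Countable.copy letter (can_type bool_of_letterK).

Notation word := (seq letter).

Definition palindrome (u : word) : bool := rev u == u.

Definition is_pal_closure (u p : word) : Prop :=
  [/\ palindrome p, prefix u p &
      forall q : word, palindrome q -> prefix u q -> size p <= size q].

(* [xget x0 P] is an element of [P] if there is one, and [x0] otherwise; here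
   [pal_closureP] and [pal_closure_unique] show that there is exactly one. *)
Definition pal_closure (u : word) : word := xget [::] [set p | is_pal_closure u p].

Lemma pal_closureP (u : word) : is_pal_closure u (pal_closure u).
Proof.
apply: (@xgetPex _ [::] [set p | is_pal_closure u p]).
pose Q n := `[< exists p : word, [/\ palindrome p, prefix u p & size p = n] >].
have exQ : exists n, Q n.
  exists (size (u ++ rev u)); apply/asboolP; exists (u ++ rev u).
  by rewrite /palindrome rev_cat revK prefix_prefix.
case: (ex_minnP exQ) => n /asboolP[p [pp up <-]] nmin.
by exists p; split=> // q qp uq; apply: nmin; apply/asboolP; exists q.
Qed.

Lemma pal_closure_unique (u p : word) : is_pal_closure u p -> p = pal_closure u.
Proof.
have := pal_closureP u; move: (pal_closure u) => q [qp uq qmin] [pp up pmin].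
have eqs : size p = size q by apply/eqP; rewrite eqn_leq pmin ?qmin.
have le2 : size p <= size u + size u.
  rewrite -{2}(size_rev u) -size_cat; apply: pmin; last exact: prefix_prefix.
  by rewrite /palindrome rev_cat revK.
move: up uq => /prefixP[s ep] /prefixP[t eq].
have nthu i : i < size u -> nth La p i = nth La q i.
  by move=> iu; rewrite ep eq !nth_cat iu.
apply: (@eq_from_nth _ La) => // i ip; have [/nthu//|ui] := ltnP i (size u).
rewrite -(eqP pp) -(eqP qp) !nth_rev -?eqs //; apply: nthu.
by rewrite ltn_subLR // addSn ltnS (leq_trans le2) // leq_add2r.
Qed.

Definition psi (v : word) : word :=
  foldl (fun (p : word) (x : letter) => pal_closure (rcons p x)) [::] v.

Definition christoffel (v : word) : word := La :: psi v ++ [:: Lb].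

Record properChristoffel : Type := ProperChristoffel {
  pc_word :> word;
  pc_wordP : exists v : word, pc_word = christoffel v
}.

(* The word [v] such that [w] is [christoffel v]; it is unique because [psi] is
   injective. *)
Definition directive (w : properChristoffel) : word := sval (cid (pc_wordP w)).

(* The exponent of the first block of the run decomposition of [v]: the position
   of the first letter different from the head, see [lead_exp_runs]. *)
Definition lead_exp (v : word) : nat :=
  if v is x :: _ then find (predC1 x) v else 0.

Lemma lead_exp_runs (r : letter * nat) (s : seq (letter * nat)) :
    all (fun t => 0 < t.2) (r :: s) ->
    sorted (fun t t' => t'.1 != t.1) (r :: s) ->
  lead_exp (flatten [seq nseq t.2 t.1 | t <- r :: s]) = r.2.
Proof.
case: r => x [//|n] /= s0 sx; rewrite eqxx /=; congr _.+1.
rewrite find_cat has_nseq /= eqxx andbF size_nseq.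
case: s s0 sx => [|[y [|m]] s] //=; first by rewrite addn0.
by move=> _ /andP[-> _]; rewrite addn0.
Qed.

Definition cindex (w : properChristoffel) : nat := lead_exp (directive w).

Definition morphism_ext (f : letter -> word) (u : word) : word := flatten (map f u).

Definition phi (k : nat) : word -> word :=
  morphism_ext (fun x => match x with
    | La => nseq k.+1 La ++ [:: Lb]
    | Lb => nseq k La ++ [:: Lb]
    end).

Definition phi_hat (k : nat) : word -> word :=
  morphism_ext (fun x => match x with
    | La => La :: nseq k Lb
    | Lb => La :: nseq k.+1 Lb
    end).

(* The preimage of [w] under an injective [f]; the empty word if there is none. *)
Definition inv_image (f : word -> word) (w : word) : word :=
  xget [::] [set u | f u = w].

Definition derivative (w : properChristoffel) : word :=
  let k := cindex w in
  if k == 0 then [:: La]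
  else match head La (directive w) with
    | La => inv_image (phi k) w
    | Lb => inv_image (phi_hat k) w
    end.

Definition nonconstant (v : word) : Prop := La \in v /\ Lb \in v.

(* [s] is a suffix of [v] preceded by a letter other than the first one of [v];
   such a [v] is nonempty, so the default of [head] is irrelevant. *)
Definition marked_suffix (v s : word) : Prop :=
  exists (p : word) (z : letter), v = p ++ z :: s /\ z <> head La v.

Definition is_plus_suffix (v s : word) : Prop :=
  marked_suffix v s /\ forall t : word, marked_suffix v t -> size t <= size s.

(* The word ${}_+v$; for non-constant [v], [plus_suffixP] shows that it exists and
   [plus_suffix_unique] that it is the only one. *)
Definition plus_suffix (v : word) : word := xget [::] [set s | is_plus_suffix v s].

Lemma marked_suffix_drop (v s : word) :
  marked_suffix v s -> s = drop (size v - size s) v.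
Proof.
case=> p [z [-> _]]; rewrite -cat_rcons size_cat addnK.
by rewrite drop_size_cat.
Qed.

Lemma is_plus_suffix_unique (v s t : word) :
  is_plus_suffix v s -> is_plus_suffix v t -> s = t.
Proof.
move=> [ms smax] [mt tmax]; rewrite (marked_suffix_drop ms) (marked_suffix_drop mt).
by congr (drop (_ - _) _); apply/eqP; rewrite eqn_leq smax ?tmax.
Qed.

Lemma plus_suffixP (v : word) : nonconstant v -> is_plus_suffix v (plus_suffix v).
Proof.
case=> va vb; apply: (@xgetPex _ [::] [set s | is_plus_suffix v s]).
have [z zv zx] : exists2 z, z \in v & z <> head La v.
  by case: (head La v); [exists Lb | exists La].
pose Q n := `[< exists s : word, marked_suffix v s /\ size s = n >].
have exQ : exists n, Q n.
  rewrite {}/Q; case/path.splitPr: zv zx => p s zx.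
  by exists (size s); apply/asboolP; exists s; split; first by exists p, z.
have Qb n : Q n -> n <= size v.
  move=> /asboolP[s [[p [y [-> _]]] <-]].
  by rewrite size_cat /= -addSnnS leq_addl.
case: (ex_maxnP exQ Qb) => n /asboolP[s [ms <-]] smax.
by exists s; split=> // t mt; apply: smax; apply/asboolP; exists t.
Qed.

Lemma plus_suffix_unique (v s : word) :
  nonconstant v -> is_plus_suffix v s -> s = plus_suffix v.
Proof. by move=> /plus_suffixP vP sP; apply: is_plus_suffix_unique sP vP. Qed.

(* Main.v *)
Require Import Defs.
From mathcomp Require Import boolp classical_sets.
From mathcomp Require Import all_boot.

(** Write [mu x] for the morphism fixing [x] and mapping the other letter [z] to
[xz].  Justin's formula [psi (x v) = mu x (psi v) x] holds because the longest
palindromic suffixes of [u] and of [mu x u x] correspond to each other under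
[s |-> mu x s x].  Iterating it along the block [x^k y] that precedes [s = _+v]
gives [psi v = M (psi s) x^k y x^k] with [M = mu x ^ k \o mu y], and [M] is
conjugate to [phi k] (if [x = a]) or to [phi_hat k] (if [x = b]). *)

Set Implicit Arguments.
Unset Strict Implicit.
Unset Printing Implicit Defensive.

Lemma morphism_ext_cat f u v :
  morphism_ext f (u ++ v) = morphism_ext f u ++ morphism_ext f v.
Proof. by rewrite /morphism_ext map_cat flatten_cat. Qed.

(** * Palindromic closure through the longest palindromic suffix *)

Lemma palindrome_suffix_overlap (u r : word) :
    palindrome (u ++ r) -> size r <= size u ->
  exists2 s, u = rev r ++ s & palindrome s.
Proof.
rewrite /palindrome rev_cat => /eqP e ru.
have eu : u = rev r ++ drop (size r) u.
  have := congr1 (take (size r)) e.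
  rewrite take_size_cat ?size_rev // takel_cat // => {1}->.
  by rewrite cat_take_drop.
exists (drop (size r) u) => //.
move: e; rewrite {1 2}eu rev_cat revK -catA => /eqP.
by rewrite eqseq_cat // eqxx /= eqseq_cat ?size_rev // => /andP[].
Qed.

Lemma palindrome_extend x u : palindrome (x :: rcons u x) = palindrome u.
Proof.
by rewrite /palindrome rev_cons rev_rcons /= eqseq_cons eqseq_rcons !eqxx andbT.
Qed.

Definition longest_pal_suffix (u s : word) :=
  [/\ suffix s u, palindrome s &
      forall r, palindrome r -> suffix r u -> size r <= size s].

Lemma longest_pal_suffix_exists u : exists s, longest_pal_suffix u s.
Proof.
pose Q n := palindrome (drop n u).
have exQ : exists n, Q n by exists (size u); rewrite /Q drop_size.
case: (ex_minnP exQ) => n Qn nmin; exists (drop n u); split=> //.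
  exact: suffix_drop.
move=> r pr /suffixP[t eu].
have := nmin (size t); rewrite /Q eu drop_size_cat // => /(_ pr) nt.
by rewrite size_drop size_cat leq_subRL ?(leq_trans nt) ?leq_addr // leq_add2r.
Qed.

(** If a palindrome extends [t ++ s] by [r] with [r] no longer than [t ++ s], then removing [rev r]
    from the front of [t ++ s] leaves a palindromic suffix. Maximality of [s] thus forces [r] to be
    at least as long as [t]. *)
Lemma pal_closure_longest t s :
  longest_pal_suffix (t ++ s) s -> pal_closure (t ++ s) = t ++ s ++ rev t.
Proof.
case=> _ /eqP ps smax; apply/esym/pal_closure_unique; split.
- by rewrite /palindrome !rev_cat revK ps -catA.
- by rewrite catA prefix_prefix.
move=> q pq /prefixP[r eq]; rewrite catA eq size_cat [leqRHS]size_cat leq_add2l.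
rewrite size_rev; have [ru|ur] := leqP (size r) (size (t ++ s)); last first.
  by apply: leq_trans (ltnW ur); rewrite size_cat leq_addr.
move: pq; rewrite eq => /palindrome_suffix_overlap/(_ ru)[s' e ps'].
have ls' : size s' <= size s by apply: smax; rewrite // e suffix_suffix.
move/(congr1 size): e; rewrite !size_cat size_rev => e.
by rewrite -(leq_add2r (size s)) e leq_add2l.
Qed.

(** * The morphism [mu x] and its action on palindromes *)

Definition mu (x : letter) : word -> word :=
  morphism_ext (fun z => if z == x then [:: x] else [:: x; z]).

Lemma mu_cat x u v : mu x (u ++ v) = mu x u ++ mu x v.
Proof. exact: morphism_ext_cat. Qed.

(** The image of every letter starts with [x]; the final [x] restores the left-right symmetry, so
    that the map commutes with reversal. *)
Definition mu_close (x : letter) (u : word) : word := rcons (mu x u) x.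

Lemma mu_close_cons x z u :
  mu_close x (z :: u) =
  if z == x then x :: mu_close x u else [:: x, z & mu_close x u].
Proof. by rewrite /mu_close /mu /morphism_ext /=; case: ifP. Qed.

Lemma mu_close_cat x u v : mu_close x (u ++ v) = mu x u ++ mu_close x v.
Proof. by rewrite /mu_close mu_cat rcons_cat. Qed.

Lemma mu_close_head x u : exists d, mu_close x u = x :: d.
Proof.
case: u => [|z u]; first by exists [::].
by rewrite mu_close_cons; case: ifP => _; eexists.
Qed.

(** Decoding goes from the left: the letter after the initial [x] is the first letter of the
    preimage, and the final [x] guarantees that it exists for a nonempty preimage. *)
Lemma mu_close_inj x : injective (mu_close x).
Proof.
elim=> [|z u IH] [|z' u'] //; rewrite ?mu_close_cons.
- by have [d e] := mu_close_head x u'; rewrite e /mu_close /=; case: ifP.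
- by have [d e] := mu_close_head x u; rewrite e /mu_close /=; case: ifP.
have [d e] := mu_close_head x u; have [d' e'] := mu_close_head x u'.
have [->|zx] := eqVneq z x; have [->|z'x] := eqVneq z' x.
- by case=> /IH->.
- by rewrite e => -[xz']; rewrite xz' eqxx in z'x.
- by rewrite e' => -[xz]; rewrite xz eqxx in zx.
- by case=> -> /IH->.
Qed.

Lemma mu_inj x : injective (mu x).
Proof. by move=> u v e; apply: (@mu_close_inj x); rewrite /mu_close e. Qed.

Lemma rev_mu_close x u : rev (mu_close x u) = mu_close x (rev u).
Proof.
elim: u => [//|z u IH].
rewrite mu_close_cons rev_cons -cats1 mu_close_cat.
have ex : mu_close x [:: z] = if z == x then [:: x; x] else [:: x; z; x].
  by rewrite mu_close_cons /mu_close.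
rewrite ex; case: ifP => _; rewrite !rev_cons IH /mu_close -!cats1 -!catA //.
Qed.

Lemma palindrome_mu_close x u : palindrome (mu_close x u) = palindrome u.
Proof. by rewrite /palindrome rev_mu_close (inj_eq (@mu_close_inj x)). Qed.

Lemma suffix_mu_close x s u : suffix s u -> suffix (mu_close x s) (mu_close x u).
Proof. by case/suffixP=> t ->; rewrite mu_close_cat suffix_suffix. Qed.

(* A suffix of [mu_close x u] starts in the middle of the image of a letter of [u]
   exactly when it starts with a letter other than [x]. *)
Lemma mu_close_suffix x u z d :
    suffix (z :: d) (mu_close x u) ->
  exists2 u2, suffix u2 u &
    mu_close x u2 = if z == x then z :: d else [:: x, z & d].
Proof.
case/suffixP=> c; elim: u c => [|y u IH] c.
  rewrite /mu_close /=; case: c => [[<- <-]|? [|? ?] //].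
  by exists [::]; rewrite ?eqxx.
move=> e; have ext c' : mu_close x u = c' ++ z :: d ->
    exists2 u2, suffix u2 (y :: u) &
    mu_close x u2 = if z == x then z :: d else [:: x, z & d].
  by move=> /IH[u2 su e2]; exists u2; rewrite // (suffix_trans su) //
    -cat1s suffix_suffix.
case: c e => [e|x' c].
  exists (y :: u); rewrite ?suffix_refl // e.
  by move: e; rewrite mu_close_cons; case: (y == x) => -[<- _]; rewrite eqxx.
rewrite mu_close_cons; case: eqVneq => [_ [_ /ext //]|yx].
(* A cut after one letter falls between the two letters of the image [x y]; a later cut leaves a
   suffix of [mu_close x u]. *)
case: c => [|y' c] [_]; last by case=> _ /ext.
case=> ez ed; exists (y :: u); rewrite ?suffix_refl // mu_close_cons.
by rewrite -ez (negbTE yx) ed.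
Qed.

(** * Longest palindromic suffixes under [mu_close] *)

Lemma suffix_leq (T : eqType) (s t u : seq T) :
  suffix s u -> suffix t u -> size s <= size t -> suffix s t.
Proof.
rewrite !suffixE => /eqP e1 /eqP e2 st.
have tu : size t <= size u by rewrite -e2 size_drop leq_subr.
have -> : drop (size t - size s) t =
    drop (size t - size s) (drop (size u - size t) u).
  by rewrite e2.
by rewrite drop_drop addnC addnBA // subnK // e1.
Qed.


(** The candidate, completed by a leading [x] if it starts inside the image of a letter, is
    [mu_close x r] for a palindromic suffix [r] of [u], and such an [r] is a suffix of [s]. *)
Lemma longest_mu_close_bound x u s z d :
    longest_pal_suffix u s -> suffix (z :: d) (mu_close x u) ->
    palindrome (if z == x then z :: d else [:: x, z & d]) ->
  size (if z == x then z :: d else [:: x, z & d]) <= size (mu_close x s).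
Proof.
case=> su _ smax /mu_close_suffix[r ru <-]; rewrite palindrome_mu_close => pr.
apply: size_suffix; apply: suffix_mu_close; exact: suffix_leq ru su (smax _ pr ru).
Qed.

Lemma palindrome_suffix_rcons (z y : letter) u d :
  palindrome (z :: d) -> suffix (z :: d) (rcons u y) -> z = y.
Proof.
move=> /eqP pd /suffixP[t]; rewrite -pd rev_cons -rcons_cat.
by move/(congr1 (last La)); rewrite !last_rcons.
Qed.

(** A nonempty palindromic suffix of [mu_close x u] ends, hence also starts, with [x], so the bound
    applies to it without completion. *)
Lemma longest_mu_close x u s :
  longest_pal_suffix u s -> longest_pal_suffix (mu_close x u) (mu_close x s).
Proof.
move=> us; have [su ps _] := us; split.
- exact: suffix_mu_close.
- by rewrite palindrome_mu_close.
case=> [//|z d] pd sd; have := longest_mu_close_bound us sd.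
by rewrite (introT eqP (palindrome_suffix_rcons pd sd)); apply.
Qed.

(** This is the inductive step of Justin's formula. With [rcons p y = t ++ s] and [s] the longest
    palindromic suffix, the part to be mirrored on the right is [mu x t] if [y = x], and [mu x t]
    followed by [x] otherwise. *)
Lemma pal_closure_mu_close x y p :
  pal_closure (rcons (mu_close x p) y) = mu_close x (pal_closure (rcons p y)).
Proof.
have [s us] := longest_pal_suffix_exists (rcons p y).
have [/suffixP[t ep] ps _] := us.
have closeE : mu_close x (rcons p y ++ rev t) =
    mu x t ++ mu_close x s ++ rev (mu x t).
  rewrite ep -catA !mu_close_cat -rev_mu_close /mu_close rev_rcons.
  by rewrite cat_rcons.
have -> : pal_closure (rcons p y) = rcons p y ++ rev t.
  by rewrite {1}ep pal_closure_longest -?ep // ep -catA.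
rewrite closeE; have [yx|yx] := eqVneq y x.
  have -> : rcons (mu_close x p) y = mu x t ++ mu_close x s.
    rewrite -mu_close_cat -ep yx -!cats1 mu_close_cat /mu_close -!cats1.
    by rewrite /mu /morphism_ext /= eqxx -catA.
  rewrite pal_closure_longest // -mu_close_cat -ep.
  exact: longest_mu_close.
(* Here the longest palindromic suffix is [s'], where [mu_close x s = x s' x]. *)
have muE : rcons (mu_close x p) y = mu x (rcons p y).
  rewrite /mu_close -!cats1 mu_cat -catA; congr (_ ++ _).
  by rewrite /mu /morphism_ext /= (negbTE yx).
(* The suffix [s] is nonempty because the single letter [y] is a palindromic suffix; hence the two
   outer letters [x] are distinct occurrences. *)
have [s' es] : exists s', mu_close x s = x :: rcons s' x.
  case: s us {ep closeE ps} => [[_ _ /(_ [:: y])]|z s _].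
    by rewrite -cats1 suffix_suffix /palindrome eqxx => /(_ isT isT).
  rewrite /mu_close /mu /morphism_ext /=; case: (z == x); first by eexists.
  by eexists (z :: _).
have ums : mu x (rcons p y) = rcons (mu x t) x ++ s'.
  have := congr1 (mu_close x) ep; rewrite mu_close_cat es /mu_close.
  by rewrite -rcons_cons -rcons_cat => /rcons_inj[->]; rewrite cat_rcons.
rewrite muE ums pal_closure_longest -?ums.
  by rewrite es cat_rcons /= rev_rcons cat_rcons.
split.
- by rewrite ums suffix_suffix.
- by rewrite -(palindrome_extend x) -es palindrome_mu_close.
case=> [//|z d] pd sd.
have zy : z = y by move: sd; rewrite -muE; apply: palindrome_suffix_rcons.
(* Adding [x] on the right makes the candidate a suffix of [mu_close x (rcons p y)]; as [z] differs
   from [x], the bound then adds the matching [x] on the left. *)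
have sd' : suffix (z :: rcons d x) (mu_close x (rcons p y)).
  by case/suffixP: sd => c e; rewrite /mu_close e rcons_cat suffix_suffix.
have := longest_mu_close_bound us sd'; rewrite zy (negbTE yx) es /= size_rcons.
rewrite size_rcons !ltnS; apply.
by rewrite -rcons_cons palindrome_extend -zy.
Qed.

(** * Justin's formula and injectivity of [psi] *)

Lemma psi_rcons v x : psi (rcons v x) = pal_closure (rcons (psi v) x).
Proof. by rewrite /psi -cats1 foldl_cat. Qed.

Lemma psi_cons x v : psi (x :: v) = mu_close x (psi v).
Proof.
elim/last_ind: v => [|v y IH].
  apply/esym/pal_closure_unique; split=> [||q _ /size_prefix //].
    by rewrite palindrome_mu_close.
  exact: (prefix_refl [:: x]).
by rewrite -rcons_cons !psi_rcons IH pal_closure_mu_close.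
Qed.

(** By Justin's formula [psi] preserves the first letter, and [mu_close] of that letter can be
    cancelled. *)
Lemma psi_inj : injective psi.
Proof.
elim=> [|x u IH] [|y v] //; rewrite !psi_cons.
- by have [d ->] := mu_close_head y (psi v).
- by have [d ->] := mu_close_head x (psi u).
have [d e] := mu_close_head x (psi u); have [d' e'] := mu_close_head y (psi v).
move=> E; have [xy] : x = y by move: E; rewrite e e' => -[].
by move: E; rewrite xy => /mu_close_inj/IH->.
Qed.

Lemma christoffel_inj : injective christoffel.
Proof.
by move=> u v [] /eqP; rewrite !cats1 eqseq_rcons andbT => /eqP/psi_inj.
Qed.

(** * Justin's formula along a block *)

Definition mu_block (x y : letter) (k : nat) (u : word) : word :=
  iter k (mu x) (mu y u).

Lemma mu_block_inj x y k : injective (mu_block x y k).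
Proof. by elim: k => [|k IH] u v /mu_inj //; apply: IH. Qed.

Lemma letter_neq_eq (x y z : letter) : x != y -> z != y -> z = x.
Proof. by case: x; case: y; case: z. Qed.

Lemma nseq_cat_cons (T : Type) k (x : T) u :
  nseq k x ++ x :: u = x :: nseq k x ++ u.
Proof. by elim: k => //= k ->. Qed.

Lemma mu_nseq x k : mu x (nseq k x) = nseq k x.
Proof.
elim: k => //= k IH.
by rewrite -[RHS]/([:: x] ++ _) -{2}IH /mu /morphism_ext /= eqxx.
Qed.

(** Each further [mu x] fixes [x] and turns [y] into [x y], so it lengthens the run in front of [y]
    by one. *)
Lemma mu_blockE x y k : x != y ->
  mu_block x y k =1
  morphism_ext (fun z => nseq k x ++ y :: (if z == y then [::] else [:: x])).
Proof.
move=> xy u; elim: k => [|k IH]; rewrite /mu_block /=.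
  congr flatten; apply: eq_map => z; case: eqVneq => // zy.
  by rewrite (letter_neq_eq xy zy).
rewrite -/(mu_block x y k u) IH.
elim: u {IH} => [//|z u IH].
rewrite [in LHS]/morphism_ext /= -/(morphism_ext _ u) mu_cat IH.
rewrite [in RHS]/morphism_ext /= -/(morphism_ext _ u) -cat_cons; congr (_ ++ _).
rewrite mu_cat mu_nseq -nseq_cat_cons; congr (_ ++ _).
rewrite /mu /morphism_ext /= eq_sym (negbTE xy) /=.
by case: (z == y); rewrite //= eqxx.
Qed.

(** Each application of Justin's formula appends one [x]; later ones fix it, so these letters
    accumulate to [x^k]. *)
Lemma psi_nseq_cat x k u :
  psi (nseq k x ++ u) = iter k (mu x) (psi u) ++ nseq k x.
Proof.
elim: k => [|k IH]; first by rewrite cats0.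
by rewrite /= psi_cons IH /mu_close mu_cat -cats1 -catA mu_nseq nseq_cat_cons
  cats0.
Qed.

Lemma iter_mu_cat x k u v :
  iter k (mu x) (u ++ v) = iter k (mu x) u ++ iter k (mu x) v.
Proof. by elim: k => //= k ->; rewrite mu_cat. Qed.

Lemma iter_mu_other x y k : x != y -> iter k (mu x) [:: y] = nseq k x ++ [:: y].
Proof.
move=> xy; elim: k => //= k ->; rewrite mu_cat mu_nseq -nseq_cat_cons.
by rewrite /mu /morphism_ext /= eq_sym (negbTE xy).
Qed.

Lemma psi_block x y k s : x != y ->
  psi (nseq k x ++ y :: s) = mu_block x y k (psi s) ++ nseq k x ++ y :: nseq k x.
Proof.
move=> xy; rewrite psi_nseq_cat psi_cons /mu_close -cats1 iter_mu_cat.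
by rewrite iter_mu_other // -!catA.
Qed.

(** * Conjugacy with [phi] and [phi_hat], and images of Christoffel words *)

Lemma phi_mu_block k u :
  nseq k La ++ Lb :: phi k u = mu_block La Lb k u ++ nseq k La ++ [:: Lb].
Proof.
rewrite mu_blockE //; elim: u => [//|z u IH].
rewrite [in RHS]/morphism_ext /= -/(morphism_ext _ u) -catA -IH.
(* On letters: [a^k b . a^(k+1) b = a^k b a . a^k b] and [a^k b . a^k b = a^k b . a^k b]. *)
rewrite /phi /morphism_ext /=; case: z => /=; rewrite -?catA //=.
Qed.

Lemma phi_hat_mu_block k u :
  nseq k Lb ++ phi_hat k u = mu_block Lb La k u ++ nseq k Lb.
Proof.
rewrite mu_blockE //; elim: u => [|z u IH]; first by rewrite cats0.
rewrite [in RHS]/morphism_ext /= -/(morphism_ext _ u) -catA -IH.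
(* On letters: [b^k . a b^k = b^k a . b^k] and [b^k . a b^(k+1) = b^k a b . b^k]. *)
rewrite /phi_hat /morphism_ext /=; case: z => /=; rewrite -?catA //=.
Qed.

Lemma cat_right_inj (T : Type) : left_injective (@cat T).
Proof.
move=> w u v; elim/last_ind: w => [|w z IH]; first by rewrite !cats0.
by rewrite -!rcons_cat => /rcons_inj[/IH].
Qed.

(** Injectivity passes from [mu_block] through the conjugacy by cancelling the common right
    factor. *)
Lemma phi_inj k : injective (phi k).
Proof.
move=> u v e; have := phi_mu_block k u; rewrite e phi_mu_block.
by move=> /cat_right_inj/mu_block_inj->.
Qed.

Lemma phi_hat_inj k : injective (phi_hat k).
Proof.
move=> u v e; have := phi_hat_mu_block k u; rewrite e phi_hat_mu_block.
by move=> /cat_right_inj/mu_block_inj->.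
Qed.

Lemma inv_imageK f : injective f -> cancel f (inv_image f).
Proof. by move=> finj u; apply: xget_unique => // v /finj. Qed.

Lemma phi_christoffel k s :
  phi k (christoffel s) = christoffel (nseq k La ++ Lb :: s).
Proof.
(* The image of the outer [a] is split as [a . a^k b], which puts the conjugating word [a^k b] in
   front of [phi k (psi s)]. *)
have -> : phi k (christoffel s) =
    La :: (nseq k La ++ Lb :: phi k (psi s)) ++ nseq k La ++ [:: Lb].
  rewrite /phi /christoffel /morphism_ext /= map_cat flatten_cat /= ?cats0.
  by rewrite -!catA.
by rewrite phi_mu_block /christoffel psi_block // -!catA.
Qed.

Lemma phi_hat_christoffel k s :
  phi_hat k (christoffel s) = christoffel (nseq k Lb ++ La :: s).
Proof.
(* Here the conjugating word [b^k] comes from the image [a b^k] of the outer [a], and the last [b]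
   of [a b^(k+1)] is split off. *)
have -> : phi_hat k (christoffel s) =
    La :: (nseq k Lb ++ phi_hat k (psi s)) ++ La :: nseq k Lb ++ [:: Lb].
  rewrite /phi_hat /christoffel /morphism_ext /= map_cat flatten_cat /= ?cats0.
  by rewrite -catA nseq_cat_cons cats0.
by rewrite phi_hat_mu_block /christoffel psi_block // -!catA.
Qed.

(** * The initial block of a non-constant word and the derivative *)

Lemma nonconstant_block v : nonconstant v ->
  exists x y k s, [/\ x != y, 0 < k & v = nseq k x ++ y :: s].
Proof.
case: v => [[] //|x v] nc.
have [y xy yv] : exists2 y, x != y & y \in v.
  by case: x nc => -[]; rewrite !inE /=; [exists Lb | exists La].
elim: v yv {nc} => [//|z v IH]; rewrite inE => yv.
have [xz|xz] := eqVneq x z; last by exists x, z, 1, v.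
move: yv; rewrite -xz eq_sym (negbTE xy) /= => /IH[x' [y' [k [s [xy' k0 e]]]]].
case: k k0 e => // k _ [ex e]; exists x', y', k.+2, s; split=> //.
by rewrite e ex.
Qed.

Lemma plus_suffix_block x y k s : x != y -> 0 < k ->
  plus_suffix (nseq k x ++ y :: s) = s.
Proof.
case: k => // k xy _; apply/esym/plus_suffix_unique.
  by split; case: x xy; case: y => //=; rewrite !(inE, mem_cat) ?eqxx ?orbT.
split; first by exists (nseq k.+1 x), y; split=> //=; apply/eqP; rewrite eq_sym.
move=> t [p [z [e /eqP/= zx]]]; rewrite leqNgt; apply/negP => st.
(* For [t] longer than [s], the letter preceding [t] lies in the initial run and so equals [x]. *)
have sp : size p < k.+1.
  move/(congr1 size): e; rewrite !size_cat size_nseq /= => e.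
  by rewrite -(ltn_add2r (size t).+1) -e ltn_add2l ltnS.
have := congr1 (nth x ^~ (size p)) e.
rewrite nth_cat size_nseq sp nth_nseq sp nth_cat ltnn subnn /= => xz.
by rewrite -xz eqxx in zx.
Qed.

Lemma lead_exp_block x y k s : x != y -> lead_exp (nseq k.+1 x ++ y :: s) = k.+1.
Proof.
move=> xy; rewrite /lead_exp /= eqxx /= find_cat has_nseq /= eqxx andbF size_nseq.
by rewrite eq_sym (negbTE xy) addn0.
Qed.

Theorem mainTheorem2 (v : word) (hv : nonconstant v)
    (w : properChristoffel) (hw : pc_word w = christoffel v) :
  derivative w = christoffel (plus_suffix v).
Proof.
(* [directive w] is obtained by choice; injectivity of [christoffel] identifies it with [v]. *)
have dw : directive w = v.
  by apply: christoffel_inj; rewrite -hw /directive; case: cid => ? /= ->.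
have [x [y [k [s [xy k0 ev]]]]] := nonconstant_block hv; case: k k0 ev => // k _ ev.
rewrite /derivative /cindex dw hw ev plus_suffix_block // lead_exp_block //=.
case: x xy {ev}; case: y => //= _.
  by rewrite -(phi_christoffel k.+1) (inv_imageK (@phi_inj _)).
by rewrite -(phi_hat_christoffel k.+1) (inv_imageK (@phi_hat_inj _)).
Qed.
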